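(* Consider RMAB-G instances with given $N$, $K$, $\mathcal{S}$, $\mathcal{A}=\{0,1\}$, rewards $R_i$, $R_{\mathrm{glob}}$ and discount $\gamma$. Let $R(\mathbf{s},\mathbf{a})=R_{\mathrm{glob}}(\mathbf{s},\mathbf{a})+\sum_{i=1}^N R_i(s_i,a_i)$ and $p_i(s_i)=\max_{\mathbf{s}':s_i'=s_i}R_{\mathrm{glob}}(\mathbf{s}',\mathbf{e}_i)$. Let $$\hat{\mathbf{a}}(\mathbf{s})=\operatorname*{arg\,max}_{\mathbf{a}\in\{0,1\}^N,\ \|\mathbf{a}\|_1\le K}\ \sum_{i=1}^N\big(R_i(s_i,a_i)+p_i(s_i)a_i\big).$$ For a set of transitions $\mathcal{P}=\{P_1,\dots,P_N\}$ and an initial state $\mathbf{s}^{(0)}$, let $$\mathrm{OPT}=\max_\pi\mathbb{E}_{(\mathbf{s},\mathbf{a})\sim(P,\pi)}\Big[\sum_{t=0}^\infty\gamma^tR(\mathbf{s}^{(t)},\mathbf{a}^{(t)})\,\Big|\,\mathbf{s}^{(0)}\Big],\qquad \mathrm{ALG}=\mathbb{E}_{(\mathbf{s},\mathbf{a})\sim(P,\pi_{\mathrm{linear}})}\Big[\sum_{t=0}^\infty\gamma^tR(\mathbf{s}^{(t)},\mathbf{a}^{(t)})\,\Big|\,\mathbf{s}^{(0)}\Big],$$ where $\pi_{\mathrm{linear}}$ is the Linear-Whittle policy. Define $$\theta_{\mathrm{linear}}=\min_{\mathbf{s}\in\mathcal{S}^N}\frac{R(\mathbf{s},\hat{\mathbf{a}}(\mathbf{s}))}{\max_{\mathbf{a}\in\{0,1\}^N,\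 \|\mathbf{a}\|_1\le K}R(\mathbf{s},\mathbf{a})}.$$ Then there exist transitions $\mathcal{P}$ and an initial state $\mathbf{s}^{(0)}$ such that $\mathrm{ALG}\le\theta_{\mathrm{linear}}\,\mathrm{OPT}$.
   Context: **RMAB-G.** There are $N$ arms with states in a finite set $\mathcal{S}$, actions in $\mathcal{A}=\{0,1\}$ (1 = pull), per-arm rewards $R_i:\mathcal{S}\times\mathcal{A}\to\mathbb{R}$, a global reward $R_{\mathrm{glob}}:\mathcal{S}^N\times\mathcal{A}^N\to\mathbb{R}$ that is, for each fixed $\mathbf{s}$, a monotone submodular set function of $\{i:a_i=1\}$, transition functions $P_i:\mathcal{S}\times\mathcal{A}\times\mathcal{S}\to[0,1]$ (arms transition independently given states and actions), $\gamma\in[0,1)$, and a budget $K$: every policy $\pi:\mathcal{S}^N\to\mathcal{A}^N$ must satisfy $\sum_i a_i^{(t)}\le K$ for all $t$. $\mathbf{e}_i$ is the $i$-th standard basis vector. **Linear-Whittle policy.** For $w\in\mathbb{R}$ let $$Q^L_{i,w}(s_i,a_i,p_i)=-a_iw+R_i(s_i,a_i)+a_ip_i(s_i)+\gamma\sum_{s_i'}P_i(s_i,a_i,s_i')V_{i,w}(s_i'),\qquad V_{i,w}(s_i')=\max_{a_i'}Q^L_{i,w}(s_i',a_i',p_i).$$ The Linear-Whittle index is $w_i^L(s_i,p_i)=\min\{w: Q^L_{i,w}(s_i,0,p_i)>Q^L_{i,w}(s_i,1,p_i)\}$ (minimum understood as infimum). The Linear-Whittle policy pulls the $K$ arms with the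 highest indices in the current state.
   Formalization: It is additionally assumed that R_glob(s,0) ≥ 0 for every s, and that ties in the argmax defining â and in the top-K choice of the Linear-Whittle policy are broken by a common priority order; without these the claim can fail. A ratio with zero denominator is read as 0. *)

(* Defs.v *)
From HB Require Import structures.
From mathcomp Require Import all_boot all_order all_algebra all_fingroup.
From mathcomp Require Import all_classical all_reals all_analysis.
(* Last, so that set0 and the set notations are those of finite sets. *)
From mathcomp Require Import finset.

Set Implicit Arguments.
Unset Strict Implicit.
Unset Printing Implicit Defensive.

Import Order.TTheory GRing.Theory Num.Theory.
Import numFieldNormedType.Exports.
Local Open Scope ring_scope.

(* A joint action a in {0,1}^N is encoded as the set
   of pulled arms {i | a_i = 1} : {set 'I_N}; hence e_i is [set i], ||a||_1 is
   #|a|, and the individual action of arm i is the boolean i \in a. *)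

Definition state (N : nat) (S : finType) := {ffun 'I_N -> S}.
Definition policy (N : nat) (S : finType) := {ffun state N S -> {set 'I_N}}.

Definition set_monotone (R : realType) (N : nat) (f : {set 'I_N} -> R) : Prop :=
  forall A B : {set 'I_N}, A \subset B -> f A <= f B.

Definition set_submodular (R : realType) (N : nat) (f : {set 'I_N} -> R) : Prop :=
  forall (A B : {set 'I_N}) (j : 'I_N), A \subset B -> j \notin B ->
    f (j |: B) - f B <= f (j |: A) - f A.

Definition feasible (N : nat) (S : finType) (K : nat) (pi : policy N S) : bool :=
  [forall s, #|pi s| <= K]%N.

Definition is_kernel (R : realType) (N : nat) (S : finType)
    (P : 'I_N -> S -> bool -> S -> R) : Prop :=
  forall i x b, (forall y, 0 <= P i x b y) /\ \sum_y P i x b y = 1.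

(* The arms move independently given the joint state and the joint action. *)
Definition joint_trans (R : realType) (N : nat) (S : finType)
    (P : 'I_N -> S -> bool -> S -> R)
    (s : state N S) (a : {set 'I_N}) (s' : state N S) : R :=
  \prod_i P i (s i) (i \in a) (s' i).

Definition reward (R : realType) (N : nat) (S : finType)
    (Rarm : 'I_N -> S -> bool -> R) (Rglob : state N S -> {set 'I_N} -> R)
    (s : state N S) (a : {set 'I_N}) : R :=
  Rglob s a + \sum_i Rarm i (s i) (i \in a).

(* Throughout, a maximum or minimum over a nonempty finite set is an iterated
   Num.max or Num.min whose initial value is a member of that set; here it is
   the value at the constant joint state x. *)
Definition pval (R : realType) (N : nat) (S : finType)
    (Rglob : state N S -> {set 'I_N} -> R) (i : 'I_N) (x : S) : R :=
  \big[Num.max/Rglob [ffun=> x] [set i]]_(s : state N S | s i == x)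
    Rglob s [set i].

Definition lin_obj (R : realType) (N : nat) (S : finType)
    (Rarm : 'I_N -> S -> bool -> R) (Rglob : state N S -> {set 'I_N} -> R)
    (s : state N S) (a : {set 'I_N}) : R :=
  \sum_i (Rarm i (s i) (i \in a) + pval Rglob i (s i) * (i \in a)%:R).

Definition is_argmax_lin (R : realType) (N : nat) (S : finType)
    (Rarm : 'I_N -> S -> bool -> R) (Rglob : state N S -> {set 'I_N} -> R)
    (K : nat) (s : state N S) (a : {set 'I_N}) : Prop :=
  (#|a| <= K)%N /\
  forall b : {set 'I_N}, (#|b| <= K)%N ->
    lin_obj Rarm Rglob s b <= lin_obj Rarm Rglob s a.

(* Tie-breaking. In state s the priorities are given by the permutation tb s,
   a smaller rank being preferred. A maximizer a agrees with these priorities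
   if, whenever exchanging a selected arm i for an unselected arm j leaves the
   objective unchanged, i has priority over j. *)
Definition ties_agree (R : realType) (N : nat) (S : finType)
    (Rarm : 'I_N -> S -> bool -> R) (Rglob : state N S -> {set 'I_N} -> R)
    (s : state N S) (sigma : 'S_N) (a : {set 'I_N}) : Prop :=
  forall i j : 'I_N, i \in a -> j \notin a ->
    lin_obj Rarm Rglob s (j |: (a :\ i)) = lin_obj Rarm Rglob s a ->
    (sigma i < sigma j)%N.

(* Q is the function Q^L_{i,w}(., ., p_i) of arm i. As gamma lies in [0, 1),
   this fixed-point equation has exactly one solution. *)
Definition is_QL (R : realType) (S : finType) (gamma : R)
    (Ri : S -> bool -> R) (Pi : S -> bool -> S -> R) (p : S -> R) (w : R)
    (Q : S -> bool -> R) : Prop :=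
  forall x b, Q x b = - (b%:R * w) + Ri x b + b%:R * p x
    + gamma * \sum_y Pi x b y * Num.max (Q y false) (Q y true).

(* The set below is nonempty and bounded from below, so that the infimum is
   a genuine real number. *)
Definition linear_index (R : realType) (S : finType) (gamma : R)
    (Ri : S -> bool -> R) (Pi : S -> bool -> S -> R) (p : S -> R) (x : S) : R :=
  inf [set w : R | exists2 Q : S -> bool -> R,
        is_QL gamma Ri Pi p w Q & Q x true < Q x false]%classic.

Definition outranks (R : realType) (N : nat) (w : 'I_N -> R) (sigma : 'S_N)
    (j i : 'I_N) : bool :=
  (w i < w j) || (w i == w j) && (sigma j < sigma i)%N.

(* outranks is a strict total order, so these are the K arms of highest index
   (all arms when N < K). *)
Definition top_arms (R : realType) (N : nat) (w : 'I_N -> R) (sigma : 'S_N)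
    (K : nat) : {set 'I_N} :=
  [set i : 'I_N | (#|[set j : 'I_N | outranks w sigma j i]| < K)%N].

Definition linear_whittle (R : realType) (N : nat) (S : finType)
    (Rarm : 'I_N -> S -> bool -> R) (Rglob : state N S -> {set 'I_N} -> R)
    (gamma : R) (K : nat) (tb : state N S -> 'S_N)
    (P : 'I_N -> S -> bool -> S -> R) : policy N S :=
  [ffun s : state N S => top_arms
     (fun i => linear_index gamma (Rarm i) (P i) (pval Rglob i) (s i))
     (tb s) K].

(* X is the controlled Markov chain of the joint states under the policy pi,
   started at s0; the finite-dimensional laws determine the law of X. *)
Definition is_trajectory (R : realType) (N : nat) (S : finType)
    (P : 'I_N -> S -> bool -> S -> R) (pi : policy N S) (s0 : state N S)
    (d : measure_display) (Omega : measurableType d) (Pr : probability Omega R)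
    (X : nat -> Omega -> state N S) : Prop :=
  (forall t s, measurable [set o | X t o = s]%classic) /\
  forall (T : nat) (x : nat -> state N S),
    Pr [set o | forall t, (t <= T)%N -> X t o = x t]%classic =
    ((x 0%N == s0)%:R *
     \prod_(t < T) joint_trans P (x t) (pi (x t)) (x t.+1))%:E.

Definition discounted_return (R : realType) (N : nat) (S : finType)
    (Rarm : 'I_N -> S -> bool -> R) (Rglob : state N S -> {set 'I_N} -> R)
    (gamma : R) (pi : policy N S) (Omega : Type) (X : nat -> Omega -> state N S)
    (o : Omega) : R :=
  limn (series (fun t => gamma ^+ t * reward Rarm Rglob (X t o) (pi (X t o)))).

(* v is the expected discounted return of pi from s0. It depends only on the
   law of the chain, hence not on the probability space carrying it. *)
Definition is_expected_return (R : realType) (N : nat) (S : finType)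
    (Rarm : 'I_N -> S -> bool -> R) (Rglob : state N S -> {set 'I_N} -> R)
    (gamma : R) (P : 'I_N -> S -> bool -> S -> R) (s0 : state N S)
    (pi : policy N S) (v : R) : Prop :=
  exists (d : measure_display) (Omega : measurableType d)
    (Pr : probability Omega R) (X : nat -> Omega -> state N S),
    is_trajectory P pi s0 Pr X /\
    ('E_Pr [discounted_return Rarm Rglob gamma pi X])%E = v%:E.

(* The largest value J pi over the policies that respect the budget. *)
Definition best_value (R : realType) (N : nat) (S : finType) (K : nat)
    (J : policy N S -> R) : R :=
  \big[Num.max/J [ffun=> set0]]_(pi : policy N S | feasible K pi) J pi.

Definition best_reward (R : realType) (N : nat) (S : finType)
    (Rarm : 'I_N -> S -> bool -> R) (Rglob : state N S -> {set 'I_N} -> R)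
    (K : nat) (s : state N S) : R :=
  \big[Num.max/reward Rarm Rglob s set0]_(a : {set 'I_N} | (#|a| <= K)%N)
    reward Rarm Rglob s a.

(* The element x0 only witnesses that S is nonempty; the value does not depend
   on it. A quotient with zero denominator is 0. *)
Definition theta_linear (R : realType) (N : nat) (S : finType) (x0 : S)
    (Rarm : 'I_N -> S -> bool -> R) (Rglob : state N S -> {set 'I_N} -> R)
    (K : nat) (ahat : state N S -> {set 'I_N}) : R :=
  let ratio s :=
    reward Rarm Rglob s (ahat s) / best_reward Rarm Rglob K s in
  \big[Num.min/ratio [ffun=> x0]]_(s : state N S) ratio s.

(* Main.v *)
(* Let every arm stay forever in its current state, whatever the action, and
   start in a joint state s0 that attains the minimum defining theta_linear.
   A policy is then worth its one-step reward in s0 divided by 1 - gamma, and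
   the Linear-Whittle index of arm i in state x is
   R_i(x, 1) - R_i(x, 0) + p_i(x), its gain in the linearized objective. So the
   Linear-Whittle policy pulls the arms of the linear maximizer ahat(s0), and
   possibly further arms, of nonpositive gain, since it spends the whole budget.
   By submodularity, the marginal reward of an arm is at most its gain, so the
   additional arms do not increase the reward. *)

Require Import Defs.
From mathcomp Require Import all_boot all_order all_algebra all_fingroup.
From mathcomp Require Import all_classical all_reals all_analysis.
From mathcomp Require Import lra.
From mathcomp Require Import finset.

Import Order.TTheory GRing.Theory Num.Theory.
Import numFieldNormedType.Exports.
Local Open Scope ring_scope.

Definition absorbing (R : realType) (N : nat) (S : finType)
  (i : 'I_N) (x : S) (b : bool) (y : S) : R := (y == x)%:R.

Definition pull_gain (R : realType) (N : nat) (S : finType)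
    (Rarm : 'I_N -> S -> bool -> R) (Rglob : state N S -> {set 'I_N} -> R)
    (i : 'I_N) (x : S) : R :=
  Rarm i x true - Rarm i x false + Defs.pval Rglob i x.

Arguments absorbing R {N S}.
Arguments pull_gain {R N S}.

(** * The controlled chain with absorbing arms *)

Section Absorbing.
Context (R : realType) (N : nat) (S : finType).
Implicit Types (i : 'I_N) (x : S) (s : state N S) (a : {set 'I_N}).

Local Notation P := (@absorbing R N S).

Lemma sum_absorbing i x b (F : S -> R) : \sum_y P i x b y * F y = F x.
Proof.
rewrite (bigD1 x) //= big1 => [|y /negPf yx].
  by rewrite /absorbing eqxx mul1r addr0.
by rewrite /absorbing yx mul0r.
Qed.

Lemma absorbing_kernel : is_kernel P.
Proof.
move=> i x b; split=> [y|]; first by rewrite /absorbing ler0n.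
by under eq_bigr do rewrite -[P _ _ _ _]mulr1; rewrite sum_absorbing.
Qed.

Lemma joint_trans_absorbing s a s' : joint_trans P s a s' = (s' == s)%:R.
Proof.
rewrite /joint_trans /absorbing -natr_prod; congr (_%:R).
have [->|ne] := eqVneq s' s; first by rewrite big1 // => i _; rewrite eqxx.
have [i nei] : exists i, s' i != s i.
  apply/existsP; rewrite -negb_forall; apply: contra ne => /forallP h.
  by apply/eqP/ffunP => i; apply/eqP.
by rewrite (bigD1 i) //= (negPf nei).
Qed.

Lemma constant_trajectory (pi : policy N S) s0 (d : measure_display)
    (Omega : measurableType d) (Pr : probability Omega R) :
  is_trajectory P pi s0 Pr (fun _ _ => s0).
Proof.
split=> [t s|T x].
  have [->|ne] := eqVneq s0 s.
    suff -> : [set _ : Omega | s = s]%classic = classical_sets.setT by exact: measurableT.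
    by apply/seteqP; split.
  suff -> : [set _ : Omega | s0 = s]%classic = classical_sets.set0.
    exact: measurable0.
  by apply/seteqP; split=> // o /= /eqP; rewrite (negPf ne).
have [h|h] := pselect (forall t, (t <= T)%N -> s0 = x t).
  have -> : [set _ : Omega | forall t, (t <= T)%N -> s0 = x t]%classic = classical_sets.setT.
    by apply/seteqP; split.
  rewrite probability_setT -(h 0%N) // eqxx mul1r big1 // => t _.
  by rewrite joint_trans_absorbing -h // -h 1?ltnW // eqxx.
have -> : [set _ : Omega | forall t, (t <= T)%N -> s0 = x t]%classic
          = classical_sets.set0.
  by apply/seteqP; split.
(* The event is empty, so the product has to vanish. By contraposition, if every factor is nonzero
   then [x] starts at [s0] and never moves, hence equals [s0] up to time [T]. *)
rewrite measure0; congr (_%:E); apply/esym/eqP; apply: contra_notT h.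
rewrite mulf_eq0 negb_or => /andP[x0 /prodf_neq0 xS] t.
move: x0; rewrite pnatr_eq0 eqb0 negbK => /eqP x0.
elim: t => [|t IH] tT; first by rewrite x0.
rewrite (IH (ltnW tT)); have := xS (Ordinal tT) isT.
by rewrite joint_trans_absorbing pnatr_eq0 eqb0 negbK => /eqP.
Qed.

End Absorbing.

(** * Returns and indices with absorbing arms *)

Section LinearIndex.
Context (R : realType) (N : nat) (S : finType) (gamma : R).
Hypotheses (gamma_ge0 : 0 <= gamma) (gamma_lt1 : gamma < 1).
Variables (Rarm : 'I_N -> S -> bool -> R).
Variables (Rglob : state N S -> {set 'I_N} -> R).

(** The trajectory is deterministic, so a one-point probability space carries it, and the return is
    a geometric series. *)
Lemma expected_return_absorbing (pi : policy N S) (s0 : state N S) :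
  is_expected_return Rarm Rglob gamma (absorbing R) s0 pi
    (reward Rarm Rglob s0 (pi s0) / (1 - gamma)).
Proof.
exists _, unit, (dirac tt : probability unit R), (fun _ _ => s0).
split; first exact: constant_trajectory.
rewrite -[RHS](@expectation_cst _ _ _ (dirac tt : probability unit R)).
congr expectation; apply/funext => o; rewrite /discounted_return.
under [X in series X]eq_fun do rewrite mulrC.
apply: (cvg_lim (@Rhausdorff R)); apply: cvg_geometric_series.
by rewrite ger0_norm.
Qed.

(** Both actions lead back to [x], so the continuation terms cancel in the comparison of [Q x true]
    with [Q x false]. The set of subsidies is therefore the open ray above the gain. *)
Lemma linear_index_absorbing (i : 'I_N) (x : S) :
  linear_index gamma (Rarm i) (absorbing R i) (Defs.pval Rglob i) x =
  pull_gain Rarm Rglob i x.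
Proof.
set m := pull_gain _ _ _ _.
rewrite /linear_index; set W := (X in inf X).
suff -> : W = `]m, +oo[%classic by rewrite inf_itv.
apply/seteqP; split => w; rewrite /= in_itv /= andbT.
  case=> Q QL; rewrite (QL x true) (QL x false) !sum_absorbing /m /pull_gain.
  rewrite !mul1r !mul0r; lra.
move=> mw; pose r y (b : bool) :=
  - (b%:R * w) + Rarm i y b + b%:R * Defs.pval Rglob i y.
(* Conversely a solution [Q] must be exhibited: the fixed-point equation reads V = max r + gamma V
   in each state, which is solved by dividing by [1 - gamma]. *)
pose V y := Num.max (r y false) (r y true) / (1 - gamma).
have VE y : V y = Num.max (r y false + gamma * V y) (r y true + gamma * V y).
  have g1 : 1 - gamma != 0 by rewrite subr_eq0 gt_eqF.
  by rewrite -addr_maxl -[X in X + _](divfK g1) -/(V y); lra.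
exists (fun y b => r y b + gamma * V y) => [y b|].
  by rewrite sum_absorbing -VE.
by rewrite ltrD2r /r !mul1r !mul0r; move: mw; rewrite /m /pull_gain; lra.
Qed.

End LinearIndex.

(** * Linear maximizers compared with the top-ranked arms *)

Section TopArms.
Context (R : realType) (N : nat) (S : finType) (K : nat).
Variables (Rarm : 'I_N -> S -> bool -> R).
Variables (Rglob : state N S -> {set 'I_N} -> R).
Implicit Types (s : state N S) (a b : {set 'I_N}).

Local Notation gain s := (fun i => pull_gain Rarm Rglob i (s i)).

Lemma lin_objE s a : lin_obj Rarm Rglob s a =
  \sum_i Rarm i (s i) false + \sum_(i in a) gain s i.
Proof.
rewrite [X in _ + X]big_mkcond -big_split; apply: eq_bigr => i _ /=.
by rewrite /pull_gain; case: (i \in a); rewrite ?mulr1 ?mulr0; lra.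
Qed.

Lemma lin_obj_setU1 s a j : j \notin a ->
  lin_obj Rarm Rglob s (j |: a) = lin_obj Rarm Rglob s a + gain s j.
Proof. by move=> ja; rewrite !lin_objE big_setU1 //=; lra. Qed.

Lemma lin_obj_swap s a i j : i \in a -> j \notin a ->
  lin_obj Rarm Rglob s (j |: (a :\ i)) =
  lin_obj Rarm Rglob s a + gain s j - gain s i.
Proof.
move=> ia ja; rewrite lin_obj_setU1; last by rewrite in_setD1 negb_and ja orbT.
by rewrite -{2}(setD1K ia) lin_obj_setU1 ?setD11 //; lra.
Qed.

Section Argmax.
Variables (s : state N S) (sigma : 'S_N) (a : {set 'I_N}).
Hypothesis a_argmax : is_argmax_lin Rarm Rglob K s a.

(** Exchange argument: swapping [i] for [j] keeps the cardinality, so maximality forces the gain of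
    [j] to be at most that of [i]. Equal gains leave the objective unchanged, and then the
    tie-breaking prefers [i]. *)
Lemma argmax_outranks i j : ties_agree Rarm Rglob s sigma a ->
  i \in a -> j \notin a -> outranks (gain s) sigma i j.
Proof.
move=> a_ties ia ja; case: a_argmax => aK a_max.
have swapE := lin_obj_swap s _ _ _ ia ja.
have cardE : #|j |: (a :\ i)| = #|a|.
  by rewrite cardsU1 in_setD1 negb_and ja orbT (cardsD1 i a) ia.
have := a_max (j |: (a :\ i)); rewrite cardE swapE => /(_ aK) le_ji.
have := a_ties i j ia ja; rewrite swapE => sig.
rewrite /outranks; have [//|gt_ji|eq_ji] := ltgtP; first lra.
by apply: sig; rewrite eq_ji addrK.
Qed.

(** An arm outranking some [i] in [a] must itself lie in [a]. Since [i] does not outrank itself,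
    these arms form a proper subset of [a], so there are fewer than [K] of them. *)
Lemma argmax_sub_top : ties_agree Rarm Rglob s sigma a ->
  a \subset top_arms (gain s) sigma K.
Proof.
move=> a_ties; have [aK _] := a_argmax.
apply/fintype.subsetP => i ia; rewrite inE; apply: leq_trans aK.
apply/proper_card/fintype.properP; split.
  apply/fintype.subsetP => j; rewrite inE => ji; apply: contraLR ji => ja.
  have := argmax_outranks _ _ a_ties ia ja; rewrite /outranks.
  by case: ltgtP => //= _; rewrite -leqNgt => /ltnW.
by exists i => //; rewrite inE /outranks ltxx ltnn andbF.
Qed.

(** All of [a] outranks [j], while fewer than [K] arms do, so the budget leaves room for [j]; a
    positive gain would contradict maximality. *)
Lemma top_minus_argmax_gain j : ties_agree Rarm Rglob s sigma a ->
  j \in top_arms (gain s) sigma K -> j \notin a -> gain s j <= 0.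
Proof.
move=> a_ties; rewrite inE => jtop ja; case: a_argmax => _ a_max.
have /a_max : (#|j |: a| <= K)%N.
  rewrite cardsU1 ja; apply: leq_ltn_trans jtop; apply/subset_leq_card.
  by apply/fintype.subsetP => i ia; rewrite inE argmax_outranks.
by rewrite lin_obj_setU1 //; lra.
Qed.

End Argmax.

Lemma pval_ge s i : Rglob s [set i] <= Defs.pval Rglob i (s i).
Proof. by rewrite /Defs.pval; apply: le_bigmax_cond. Qed.

Hypothesis Rglob_ge0 : forall s, 0 <= Rglob s set0.
Hypothesis Rglob_submod : forall s, set_submodular (Rglob s).

(* Submodularity bounds the marginal value of j by Rglob s [set j], hence by
   pval. *)
Lemma reward_setU1 s a j : j \notin a ->
  reward Rarm Rglob s (j |: a) <= reward Rarm Rglob s a + gain s j.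
Proof.
move=> ja; have := Rglob_submod s _ _ _ (sub0set a) ja; rewrite setU0 => marg.
have pj := pval_ge s j; have g0 := Rglob_ge0 s.
rewrite /reward (bigD1 j) //= [X in _ <= _ + X + _](bigD1 j) //=.
rewrite (negPf ja) setU11.
rewrite (eq_bigr (fun i => Rarm i (s i) (i \in a))) => [|i /negPf ij].
  by rewrite /pull_gain; lra.
by rewrite in_setU1 ij.
Qed.

(** Induction on the number of extra arms, removing one at a time. *)
Lemma reward_superset s a b : a \subset b ->
  (forall j, j \in b -> j \notin a -> gain s j <= 0) ->
  reward Rarm Rglob s b <= reward Rarm Rglob s a.
Proof.
have [n] := ubnP #|b :\: a|; elim: n b => // n IH b bn ab gain_le0.
have [/eqP|[j]] := set_0Vmem (b :\: a).
  by rewrite setD_eq0 => ba; have -> : b = a by apply/eqP; rewrite eqEsubset ba.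
rewrite inE => /andP[ja jb]; rewrite -(setD1K jb).
have jb' : j \notin b :\ j by rewrite setD11.
apply: le_trans (reward_setU1 s _ _ jb') _.
have gain_j := gain_le0 j jb ja.
suff : reward Rarm Rglob s (b :\ j) <= reward Rarm Rglob s a by lra.
apply: IH => [||i]; last by rewrite in_setD1 => /andP[_ ib]; exact: gain_le0.
  move: bn; rewrite (cardsD1 j) inE ja jb /= add1n ltnS; apply: leq_trans.
  by rewrite ltnS; apply/subset_leq_card/fintype.subsetP => i;
     rewrite !inE => /and3P[-> -> ->].
by rewrite subsetD1 ab.
Qed.

Lemma reward_top_le s (sigma : 'S_N) a :
  is_argmax_lin Rarm Rglob K s a -> ties_agree Rarm Rglob s sigma a ->
  reward Rarm Rglob s (top_arms (gain s) sigma K) <= reward Rarm Rglob s a.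
Proof.
move=> a_argmax a_ties; apply: reward_superset.
  exact: argmax_sub_top.
by move=> j; apply: top_minus_argmax_gain.
Qed.

(** Only the action taken in [s] counts, and constant policies realize every action within the
    budget. *)
Lemma best_value_scale s (c : R) : 0 <= c ->
  best_value K (fun pi : policy N S => reward Rarm Rglob s (pi s) * c) =
  best_reward Rarm Rglob K s * c.
Proof.
move=> c_ge0; apply/eqP; rewrite eq_le; apply/andP; split.
  apply: bigmax_le => [|pi /forallP/(_ s) piK]; apply: ler_wpM2r => //.
    by rewrite ffunE; apply: le_bigmax_cond; rewrite cards0.
  exact: le_bigmax_cond.
have maxM : {morph (fun y : R => y * c) : x y / Num.max x y}.
  by move=> x y; rewrite maxr_pMl.
rewrite /best_reward (big_morph _ maxM (erefl _)); apply: bigmax_le => [|a aK].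
  apply: (bigmax_sup [ffun=> set0]); rewrite ?ffunE //.
  by apply/forallP => ?; rewrite ffunE cards0.
apply: (bigmax_sup [ffun=> a]); rewrite ?ffunE //.
by apply/forallP => ?; rewrite ffunE.
Qed.

End TopArms.

Theorem theorem6 (R : realType) (N : nat) (S : finType) (x0 : S) (K : nat)
    (Rarm : 'I_N -> S -> bool -> R) (Rglob : state N S -> {set 'I_N} -> R)
    (gamma : R)
    (gamma_ge0 : 0 <= gamma) (gamma_lt1 : gamma < 1)
    (Rglob_ge0 : forall s, 0 <= Rglob s set0)
    (Rglob_mono : forall s, set_monotone (Rglob s))
    (Rglob_submod : forall s, set_submodular (Rglob s))
    (tb : state N S -> 'S_N) (ahat : state N S -> {set 'I_N})
    (ahat_argmax : forall s, is_argmax_lin Rarm Rglob K s (ahat s))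
    (ahat_ties : forall s, ties_agree Rarm Rglob s (tb s) (ahat s)) :
  exists (P : 'I_N -> S -> bool -> S -> R) (s0 : state N S)
      (J : policy N S -> R),
    [/\ is_kernel P,
        forall pi, feasible K pi ->
          is_expected_return Rarm Rglob gamma P s0 pi (J pi) &
        J (linear_whittle Rarm Rglob gamma K tb P) <=
          theta_linear x0 Rarm Rglob K ahat * best_value K J].
Proof.
pose ratio s := reward Rarm Rglob s (ahat s) / best_reward Rarm Rglob K s.
(* The iterated minimum is attained, since the minimum of two values is one of them. *)
have [s0 theta_s0] : exists s0, theta_linear x0 Rarm Rglob K ahat = ratio s0.
  rewrite /theta_linear -/ratio; elim/big_ind: _ => [|x y [s ->] [t ->]|s _].
  - by exists [ffun=> x0].
  - by rewrite minElt; case: ifP => _; [exists s | exists t].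
  - by exists s.
pose c := (1 - gamma)^-1.
have c_ge0 : 0 <= c by rewrite invr_ge0 subr_ge0 ltW.
exists (absorbing R), s0, (fun pi => reward Rarm Rglob s0 (pi s0) * c).
split; first exact: absorbing_kernel.
  by move=> pi _; apply: expected_return_absorbing.
rewrite best_value_scale // theta_s0 mulrA ler_wpM2r // ffunE.
under [X in top_arms X]eq_fun do rewrite linear_index_absorbing //.
have top_le := @reward_top_le _ _ _ K _ _ Rglob_ge0 Rglob_submod
  s0 _ _ (ahat_argmax s0) (ahat_ties s0).
apply: le_trans top_le _; rewrite /ratio.
(* If the best reward is zero, the right-hand side is zero too, and the reward of [ahat s0] is at
   most the best reward. Otherwise the quotient cancels, whatever the sign of the denominator. *)
have [best0|best_neq0] := eqVneq (best_reward Rarm Rglob K s0) 0.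
  rewrite best0 mulr0 -best0; apply: le_bigmax_cond.
  by case: (ahat_argmax s0).
by rewrite divfK.
Qed.
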